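(* Let $\mu>0$, let $X$ be a Poisson random variable with mean $\mu$, and let $k$ be a positive integer. Then $$\mathrm{E}[X^k]\ge\mu^k\left(1+\frac{k(k-1)}{2\mu}\right).$$ *)

(* Defs.v *)
From HB Require Import structures.
From mathcomp Require Import all_boot all_order all_algebra.
From mathcomp Require Import all_classical all_reals all_analysis.

Set Implicit Arguments.
Unset Strict Implicit.
Unset Printing Implicit Defensive.

Import Order.TTheory GRing.Theory Num.Theory.
Import numFieldNormedType.Exports.

Local Open Scope classical_set_scope.
Local Open Scope ring_scope.

(* The probabilities P (X = n), n : nat, sum to 1, so they determine the law
   of the real-valued X; X may take non-integer values on a negligible set.
   The rate is left existential: it is pinned down by the mean of X. *)
Definition poisson_rv (d : measure_display) (T : measurableType d)
    (R : realType) (P : probability T R) (X : {RV P >-> R}) : Prop :=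
  exists2 rate : R, 0 < rate &
    forall n : nat, P (X @^-1` [set n%:R]) = (poisson_pmf rate n)%:E.

(* Main.v *)
Require Import Defs.
From HB Require Import structures.
From mathcomp Require Import all_boot all_order all_algebra.
From mathcomp Require Import all_classical all_reals all_analysis.
From mathcomp Require Import measurable_realfun ring.

Set Implicit Arguments.
Unset Strict Implicit.
Unset Printing Implicit Defensive.

Import Order.TTheory GRing.Theory Num.Theory.
Import numFieldNormedType.Exports.

Local Open Scope ring_scope.

(** The Poisson law is characterised by the Stein-Chen identity
    [E[X g(X)] = mu E[g(X + 1)]].  With [g(n) = n ^ k] it reads
    [E[X^(k+1)] = mu E[(X + 1)^k]], and the first two terms of the binomial
    expansion of [(X + 1)^k] give the recursive inequality
    [E[X^(k+1)] >= mu (E[X^k] + k E[X^(k-1)])] ([poisson_momentS_ge]).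
    Starting from [E[X^0] = 1], induction on [k] yields
    [E[X^k] >= mu^k + 'C(k, 2) mu^(k-1)] ([poisson_moment_ge]), which is the
    announced bound.  The coefficient propagates by Pascal's rule
    ['C(k + 1, 2) = 'C(k, 2) + k]; the bound [E[X^(k-1)] >= mu^(k-1)] needed
    for the other term is a weakening of the induction hypothesis.

    These moments are series over [nat].  They are the expectations of the
    theorem because a random variable whose point masses on [nat] sum to [1]
    is almost surely a natural number ([expectation_nat_valued]).  The
    Stein-Chen identity with [g = 1] identifies the rate with the mean. *)

(** The complement of the event that [X] is a natural number is negligible,
    so the expectation is an integral over the disjoint events [X = n], on each
    of which the integrand is constant.  Nonnegativity of [f] is only assumed
    on [nat]: it may fail at the negligible values of [X], as it does for odd
    powers. *)
Lemma expectation_nat_valued (d : measure_display) (T : measurableType d)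
    (R : realType) (P : probability T R) (X : {RV P >-> R}) (f : R -> R) :
  (\sum_(n <oo) P (X @^-1` [set n%:R])%classic = 1)%E ->
  measurable_fun setT f -> (forall n : nat, 0 <= f n%:R) ->
  ('E_P[(fun w => f (X w))] =
     \sum_(n <oo) (f n%:R)%:E * P (X @^-1` [set n%:R])%classic)%E.
Proof.
move=> P1 mf f0.
pose A (n : nat) : set T := (X @^-1` [set n%:R])%classic.
have mA n : measurable (A n) by exact: measurable_sfunP.
have tA : trivIset setT A.
  move=> i j _ _ [w [Xi Xj]]; apply/eqP.
  by rewrite -(eqr_nat R) -Xi -Xj.
pose U : set T := (\bigcup_n A n)%classic.
have mU : measurable U by exact: bigcupT_measurable.
have PU : P (~` U)%classic = 0%E.
  by rewrite probability_setC// measure_semi_bigcup// P1 subee.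
pose g w : \bar R := (f (X w))%:E.
have mg : measurable_fun setT g.
  by apply/measurable_EFinP; exact: measurableT_comp.
rewrite unlock.
rewrite (_ : (\int[P]_w g w = \int[P]_w (g \_ U)%classic w)%E) //; last first.
  apply: ae_eq_integral => //.
    by apply/(measurable_restrictT _ mU).1; exact: measurable_funTS.
  exists (~` U)%classic; split => //; first exact: measurableC.
  move=> w /= gU Uw; apply: gU => _.
  by rewrite /patch mem_set.
rewrite -integral_mkcond ge0_integral_bigcup//; first last.
- by move=> w [n _ Xw]; rewrite /g Xw lee_fin.
- exact: measurable_funTS.
apply: eq_eseriesr => n _.
rewrite -integral_cst//; apply: eq_integral => w /set_mem Xw.
by rewrite /g Xw.
Qed.

Lemma poisson_pmf_sum (R : realType) (r : R) : 0 < r ->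
  (\sum_(n <oo) (poisson_pmf r n)%:E = 1)%E.
Proof.
move=> r0; rewrite nneseries_esumT; last first.
  by move=> n; rewrite lee_fin poisson_pmf_ge0.
have : poisson_prob r 0 setT = 1%E by exact: probability_setT.
by rewrite /poisson_prob r0.
Qed.

Lemma poisson_pmfS (R : realType) (r : R) (n : nat) : 0 < r ->
  n.+1%:R * poisson_pmf r n.+1 = r * poisson_pmf r n.
Proof.
move=> r0; rewrite /poisson_pmf r0 factS natrM exprS.
by field; rewrite nat1r !pnatr_eq0 -lt0n fact_gt0.
Qed.

(** The Stein-Chen identity: the term of index [0] on the left vanishes, and the
    others are matched by [poisson_pmfS] after a shift. *)
Lemma poisson_stein_chen (R : realType) (r : R) (g : nat -> R) :
  0 < r -> (forall n, 0 <= g n) ->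
  (\sum_(n <oo) (n%:R * g n * poisson_pmf r n)%:E =
     r%:E * \sum_(n <oo) (g n.+1 * poisson_pmf r n)%:E)%E.
Proof.
move=> r0 g0.
rewrite nneseries_recl//; last first.
  by move=> n _; rewrite lee_fin !mulr_ge0// poisson_pmf_ge0.
rewrite !mul0r add0e -nneseries_addn; last first.
  by move=> n; rewrite lee_fin !mulr_ge0// poisson_pmf_ge0.
rewrite -nneseriesZl; last first.
  by move=> n _; rewrite lee_fin mulr_ge0// poisson_pmf_ge0.
apply: eq_eseriesr => n _; rewrite addn1 -EFinM; congr EFin.
by rewrite [_ * g _]mulrC -mulrA poisson_pmfS// mulrCA.
Qed.

Definition poisson_moment (R : realType) (r : R) (k : nat) : \bar R :=
  (\sum_(n <oo) (n%:R ^+ k * poisson_pmf r n)%:E)%E.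

Lemma poisson_moment0 (R : realType) (r : R) : 0 < r ->
  poisson_moment r 0 = 1%E.
Proof.
move=> r0; rewrite -(poisson_pmf_sum r0); apply: eq_eseriesr => n _.
by rewrite mul1r.
Qed.

Lemma poisson_momentS (R : realType) (r : R) (k : nat) : 0 < r ->
  poisson_moment r k.+1 =
    (r%:E * \sum_(n <oo) (n.+1%:R ^+ k * poisson_pmf r n)%:E)%E.
Proof.
move=> r0; rewrite -(poisson_stein_chen (g := fun n => n%:R ^+ k))//.
by apply: eq_eseriesr => n _; rewrite exprS.
Qed.

Lemma poisson_mean (R : realType) (r : R) : 0 < r ->
  poisson_moment r 1 = r%:E.
Proof.
move=> r0; rewrite poisson_momentS// -[RHS]mule1 -(poisson_moment0 r0).
by congr (_ * _)%E; apply: eq_eseriesr => n _; rewrite !expr0.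
Qed.

(** The first two terms of the binomial expansion; for [k = 0] the second one
    is [0], whatever the truncated exponent. *)
Lemma exprS_ge2terms (n k : nat) : (n ^ k + k * n ^ k.-1 <= n.+1 ^ k)%N.
Proof.
elim: k => [|k IH]; first by rewrite !expn0.
rewrite [leqRHS]expnS (leq_trans _ (leq_mul (leqnn _) IH))//.
rewrite mulnDr !mulSn expnS /= addnAC addnC leq_add//.
case: k {IH} => [|k] /=; first by rewrite !mul0n muln0.
by rewrite mulnCA -expnS leq_add2l leq_addl.
Qed.

Lemma poisson_momentS_ge (R : realType) (r : R) (k : nat) : 0 < r ->
  (r%:E * (poisson_moment r k + k%:R%:E * poisson_moment r k.-1)
     <= poisson_moment r k.+1)%E.
Proof.
move=> r0; rewrite poisson_momentS// lee_pmul2l ?lte_fin//.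
have pos j n : (0 <= (n%:R ^+ j * poisson_pmf r n)%:E)%E.
  by rewrite lee_fin mulr_ge0 ?exprn_ge0// poisson_pmf_ge0.
have kpos n : (0 <= k%:R%:E * (n%:R ^+ k.-1 * poisson_pmf r n)%:E)%E.
  by rewrite mule_ge0// lee_fin.
rewrite -nneseriesZl// -nneseriesD//.
apply: lee_nneseries => n *; first by rewrite adde_ge0.
rewrite -EFinM -EFinD lee_fin mulrA -mulrDl ler_wpM2r ?poisson_pmf_ge0//.
by rewrite -!natrX -natrM -natrD ler_nat exprS_ge2terms.
Qed.

(** In terms of Stirling numbers, [E[X^k] = \sum_j S(k, j) r^j], and the bound
    keeps the two terms [S(k, k) = 1] and [S(k, k-1) = 'C(k, 2)]. *)
Lemma poisson_moment_ge (R : realType) (r : R) (k : nat) : 0 < r ->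
  ((r ^+ k + 'C(k, 2)%:R * r ^+ k.-1)%:E <= poisson_moment r k)%E.
Proof.
move=> r0.
suff [] : ((r ^+ k + 'C(k, 2)%:R * r ^+ k.-1)%:E <= poisson_moment r k)%E /\
          ((r ^+ k.-1)%:E <= poisson_moment r k.-1)%E by [].
elim: k => [|k [IHk IHk1]].
  by rewrite poisson_moment0// bin0n mul0r addr0.
split; last first.
  by apply: le_trans IHk; rewrite lee_fin lerDl mulr_ge0// exprn_ge0// ltW.
apply: le_trans (poisson_momentS_ge k r0).
rewrite (_ : r ^+ k.+1 + _ =
    r * (r ^+ k + 'C(k, 2)%:R * r ^+ k.-1 + k%:R * r ^+ k.-1)); last first.
  rewrite binS bin1 natrD; case: k {IHk IHk1} => [|k].
    by rewrite bin0n /=; ring.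
  by rewrite /= !exprS; ring.
rewrite EFinM lee_pmul2l ?lte_fin// EFinD leeD//.
by rewrite EFinM lee_wpmul2l// lee_fin.
Qed.

Theorem mainTheorem4 (R : realType) (d : measure_display)
    (T : measurableType d) (P : probability T R) (X : {RV P >-> R})
    (mu : R) (k : nat) (hmu : 0 < mu) (hX : poisson_rv X)
    (hmean : 'E_P[X]%E = mu%:E) (hk : (0 < k)%N) :
  ((mu ^+ k * (1 + (k%:R * (k%:R - 1)) / (2 * mu)))%:E
     <= 'E_P[(fun w => X w ^+ k)%R])%E.
Proof.
case: hX => r r0 Xr.
have momentE j : 'E_P[(fun w => X w ^+ j)%R]%E = poisson_moment r j.
  rewrite (expectation_nat_valued (f := fun x => x ^+ j)).
  - by apply: eq_eseriesr => n _; rewrite Xr -EFinM.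
  - by rewrite -[RHS](poisson_pmf_sum r0); apply: eq_eseriesr => n _; exact: Xr.
  - exact: exprn_measurable.
  - by move=> n; exact: exprn_ge0.
have rmu : r = mu.
  apply: EFin_inj; rewrite -hmean -(poisson_mean r0) -momentE.
  by congr ('E_P[_])%E; apply/funext => w; rewrite expr1.
rewrite momentE rmu; apply: le_trans (poisson_moment_ge k hmu).
have kk1 : k%:R * (k%:R - 1) = 2 * 'C(k, 2)%:R :> R.
  by case: k hk => // k _; rewrite -natrM -mul_bin_diag bin1 natrM -natr1 addrK.
rewrite kk1 lee_fin; case: k hk {kk1} => // k _ /=.
rewrite le_eqVlt; apply/orP; left; apply/eqP.
by rewrite exprS; field; rewrite gt_eqF.
Qed.
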